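(* For every integer $d\geq 5$, the three sign patterns of length $d+1$ $$\Sigma_{[2],d-2,[1]},\qquad \Sigma_{2,[d-4],3},\qquad \Sigma_{3,[d-4],2}$$ are canonical, where $[k]$ stands for $k$ consecutive components equal to $1$ (so the first is $\Sigma_{1,1,d-2,1}$ and the second and third are $\Sigma_{2,1,\ldots,1,3}$ and $\Sigma_{3,1,\ldots,1,2}$ with $d-4$ ones). Moreover $\Sigma_{[2],d-2,[1]}=\sigma^r(\Sigma_{[1],d-2,[2]})$, $\Sigma_{2,[d-4],3}=\sigma^m(\Sigma_{[1],d-2,[2]})$ and $\Sigma_{3,[d-4],2}=\sigma^{mr}(\Sigma_{[1],d-2,[2]})$.
   Context: All polynomials are real, univariate, monic, with all coefficients nonvanishing. Such a polynomial is a hyperbolic polynomial (HP) if all its roots are real. A sign pattern (SP) of length $d+1$ is a sequence of $d+1$ signs $+$ or $-$ beginning with $+$. The SP of $P=\sum_{j=0}^d a_jx^j$ ($a_d=1$, all $a_j\in\mathbb{R}\setminus\{0\}$) is $\sigma(P)=(+,\mathrm{sgn}(a_{d-1}),\ldots,\mathrm{sgn}(a_0))$; we say that $P$ realizes $\sigma(P)$. By Descartes' rule of signs, an HP has exactly as many positive (resp. negative) roots, counted with multiplicity, as there are sign changes (resp. sign preservations) between consecutive signs of $\sigma(P)$. For positive integers $m_1,\ldots,m_s$ with $m_1+\cdots+m_s=d+1$, $\Sigma_{m_1,\ldots,m_s}$ denotes the SP consisting of $m_1$ signs $+$, followed by $m_2$ signs $-$, followed by $m_3$ signs $+$, etc.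 For an SP $\sigma=\sigma(P)$ of length $d+1$, set $\sigma^m=\sigma((-1)^dP(-x))$ and $\sigma^r=\sigma(x^dP(1/x)/P(0))$; these depend only on $\sigma$, and the two operations are commuting involutions on SPs of length $d+1$. Their composition is denoted $\sigma^{mr}$. Change-preservation pattern (CPP): to an SP of length $d+1$ one associates the word of length $d$ in the letters $c,p$ whose $j$-th letter ($1\le j\le d$) is $p$ if the signs in positions $j$ and $j+1$ of the SP are equal and $c$ if they are different. Canonical order: read the CPP of $\sigma$ from right to left and replace each $p$ by $N$ and each $c$ by $P$, obtaining a word $(w_1,\ldots,w_d)$. An HP realizing $\sigma$ whose roots have pairwise distinct moduli $0<\gamma_1<\cdots<\gamma_d$ has canonical order of the moduli of its roots if, for each $i$, the root of modulus $\gamma_i$ is positive when $w_i=P$ and negative when $w_i=N$. An SP $\sigma$ is canonical if every HP that realizes $\sigma$ and whose roots have pairwise distinct moduli has canonical order of the moduli of its roots. *)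

(* Defs.v *)
From HB Require Import structures.
From mathcomp Require Import all_boot all_order all_algebra.
From mathcomp Require Import complex.
From mathcomp Require Import reals.

Set Implicit Arguments.
Unset Strict Implicit.
Unset Printing Implicit Defensive.

Import Order.TTheory GRing.Theory Num.Theory.
Local Open Scope ring_scope.

(* A sign is a boolean, [true] standing for + and [false] for -; a sign pattern
   is listed from the leading sign down to the sign of the constant term. *)
Definition is_SP (d : nat) (s : seq bool) : Prop :=
  size s = d.+1 /\ head false s = true.

Fixpoint sign_blocks (b : bool) (ms : seq nat) : seq bool :=
  if ms is m :: ms' then nseq m b ++ sign_blocks (~~ b) ms' else [::].

(* Sigma_{m_1,...,m_s} *)
Definition Sigma (ms : seq nat) : seq bool := sign_blocks true ms.

(* The letter c is encoded as [true] and p as [false]. *)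
Definition change_preservation (s : seq bool) : seq bool :=
  if s is a :: s' then pairmap (fun x y => x != y) a s' else [::].

(* Replacing p by N and c by P, with P encoded as [true] and N as [false],
   leaves the boolean letters unchanged. *)
Definition canonical_word (s : seq bool) : seq bool :=
  rev (change_preservation s).

Section Polynomials.
Variable R : realFieldType.
Implicit Types (P : {poly R}) (rs : seq R).

(* the standing assumptions on all polynomials *)
Definition admissible P : Prop :=
  P \is monic /\ forall j, (j < size P)%N -> P`_j != 0.

Definition sign_pattern P : seq bool := [seq 0 < a | a <- rev P].

(* (-1)^d P(-x), d = deg P *)
Definition mirror P : {poly R} := (-1) ^+ (size P).-1 *: (P \Po (- 'X)).

(* x^d P(1/x) / P(0), d = deg P *)
Definition reversal P : {poly R} :=
  P.[0]^-1 *: \poly_(j < size P) P`_((size P).-1 - j).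

(* A particular polynomial with sign pattern [s], its coefficients being 1 and
   -1.  The lemmas [sigma_mE] and [sigma_rE] below show that the
   two involutions do not depend on this choice. *)
Definition SP_poly (s : seq bool) : {poly R} :=
  Poly [seq if b then 1 else -1 | b <- rev s].

Definition sigma_m (s : seq bool) : seq bool :=
  sign_pattern (mirror (SP_poly s)).

Definition sigma_r (s : seq bool) : seq bool :=
  sign_pattern (reversal (SP_poly s)).

Definition sigma_mr (s : seq bool) : seq bool := sigma_m (sigma_r s).

(* [rs] lists all the roots of P with multiplicity, their moduli satisfying
   0 < gamma_1 < ... < gamma_d. *)
Definition roots_by_modulus P rs : Prop :=
  P = \prod_(r <- rs) ('X - r%:P) /\ path <%R 0 [seq `|r| | r <- rs].

Definition distinct_moduli P : Prop := exists rs, roots_by_modulus P rs.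

Definition canonical_order P : Prop :=
  exists2 rs, roots_by_modulus P rs &
    forall i, (i < size rs)%N ->
      if nth false (canonical_word (sign_pattern P)) i
      then 0 < rs`_i else rs`_i < 0.

End Polynomials.

Definition hyperbolic (R : rcfType) (P : {poly R}) : Prop :=
  forall z : R[i], root (map_poly (real_complex R) P) z -> complex.Im z = 0.

Definition is_HP (R : rcfType) (P : {poly R}) : Prop :=
  admissible P /\ hyperbolic P.

Definition canonical (R : rcfType) (d : nat) (s : seq bool) : Prop :=
  is_SP d s /\
  forall P : {poly R}, is_HP P -> sign_pattern P = s ->
    distinct_moduli P -> canonical_order P.

Section WellDefined.
Variable R : realFieldType.
Implicit Types P Q : {poly R}.

Lemma sign_patternE P : sign_pattern P =
  mkseq (fun i => 0 < P`_((size P).-1 - i)) (size P).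
Proof.
apply: (@eq_from_nth _ false); first by rewrite size_map size_rev size_mkseq.
move=> i; rewrite size_map size_rev => ltiP.
by rewrite (nth_map 0) ?size_rev // nth_mkseq // nth_rev // -subn1 -subnDA add1n.
Qed.

Lemma sign_pattern_inj P Q : sign_pattern P = sign_pattern Q ->
  size P = size Q /\
  forall j, (j < size P)%N -> (0 < P`_j) = (0 < Q`_j).
Proof.
move=> eqPQ; have eqs : size P = size Q.
  by have := congr1 size eqPQ; rewrite !size_map !size_rev.
split=> // j ltj; have := congr1 (fun s => nth false (rev s) j) eqPQ.
by rewrite -!map_rev !revK !(nth_map 0) // -eqs.
Qed.

Lemma pos_mull (c a b : R) : a != 0 -> b != 0 -> (0 < a) = (0 < b) ->
  (0 < c * a) = (0 < c * b).
Proof.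
case: (ltgtP a 0) => // a0 _; case: (ltgtP b 0) => // b0 _ _.
  by rewrite !nmulr_lgt0.
by rewrite !pmulr_lgt0.
Qed.

Lemma size_mirror P : size (mirror P) = size P.
Proof.
rewrite /mirror size_scale ?signr_eq0 // size_comp_poly2 //.
by rewrite size_polyN size_polyX.
Qed.

Lemma coef_mirror P j : (mirror P)`_j = (-1) ^+ ((size P).-1 + j) * P`_j.
Proof.
rewrite /mirror coefZ exprD -mulrA; congr (_ * _).
have -> : - 'X = (-1)%:P * 'X :> {poly R} by rewrite polyCN mulN1r.
rewrite comp_polyE coef_sum.
under eq_bigr => i _ do
  rewrite exprMn -polyC_exp coefZ coefCM coefXn.
case: (ltnP j (size P)) => ltj.
  rewrite (bigD1 (Ordinal ltj)) //= eqxx mulr1 big1 ?addr0 1?mulrC //.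
  move=> i neij; rewrite eq_sym; case: eqP => [eqij|]; last by rewrite !mulr0.
  by case/eqP: neij; apply: val_inj.
rewrite [P`_j]nth_default // mulr0 big1 // => i _.
by rewrite gtn_eqF ?mulr0 // (leq_trans (ltn_ord i)).
Qed.

Lemma admissible_neq0 P : admissible P -> P != 0.
Proof. by case=> /monic_neq0. Qed.

Lemma size_reversal P : admissible P -> size (reversal P) = size P.
Proof.
case=> monP nzP; have P0 : (0 < size P)%N by rewrite size_poly_gt0 monic_neq0.
rewrite /reversal size_scale ?invr_eq0 ?horner_coef0 ?nzP //.
by rewrite size_poly_eq // subnn nzP.
Qed.

Lemma sign_pattern_mirror P Q : admissible P -> admissible Q ->
  sign_pattern P = sign_pattern Q ->
  sign_pattern (mirror P) = sign_pattern (mirror Q).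
Proof.
move=> [monP nzP] [_ nzQ] /sign_pattern_inj[eqs sgn].
have P0 : (0 < size P)%N by rewrite size_poly_gt0 monic_neq0.
rewrite !sign_patternE !size_mirror -eqs; apply: eq_mkseq => i.
have ltj : ((size P).-1 - i < size P)%N by rewrite (leq_ltn_trans (leq_subr _ _)) // prednK.
by rewrite !coef_mirror -eqs; apply: pos_mull; rewrite ?nzP ?nzQ ?sgn -?eqs.
Qed.

Lemma sign_pattern_reversal P Q : admissible P -> admissible Q ->
  sign_pattern P = sign_pattern Q ->
  sign_pattern (reversal P) = sign_pattern (reversal Q).
Proof.
move=> admP admQ /sign_pattern_inj[eqs sgn].
have [[monP nzP] [_ nzQ]] := (admP, admQ).
have P0 : (0 < size P)%N by rewrite size_poly_gt0 monic_neq0.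
rewrite !sign_patternE !size_reversal // -eqs; apply: eq_mkseq => i.
have lt k : ((size P).-1 - k < size P)%N by rewrite (leq_ltn_trans (leq_subr _ _)) // prednK.
rewrite !coefZ !coef_poly -eqs lt !horner_coef0.
set k := (_ - (_ - i))%N; have ltk : (k < size P)%N by exact: lt.
rewrite (@pos_mull _ _ Q`_k) ?nzP ?nzQ ?sgn -?eqs // ![_ * Q`_k]mulrC.
by apply: pos_mull; rewrite ?invr_eq0 ?nzP ?nzQ ?invr_gt0 ?sgn -?eqs.
Qed.

Lemma SP_polyK d s : is_SP d s ->
  SP_poly R s = [seq if b then 1 else -1 | b <- rev s] :> seq R.
Proof.
case: s => [|[] s] [//= _ //] _; rewrite (@PolyK _ 0) //.
by rewrite rev_cons map_rcons last_rcons oner_neq0.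
Qed.

Lemma SP_poly_admissible d s : is_SP d s -> admissible (SP_poly R s).
Proof.
move=> sP; have sE := SP_polyK sP; split.
  rewrite monicE lead_coefE sE; case: s sP {sE} => [|[] s] [//= _ //] _.
  by rewrite nth_last rev_cons map_rcons last_rcons.
move=> j; rewrite sE size_map => ltj; rewrite (nth_map false) //.
by case: ifP; rewrite ?oppr_eq0 oner_neq0.
Qed.

Lemma sign_pattern_SP_poly d s : is_SP d s -> sign_pattern (SP_poly R s) = s.
Proof.
move=> sP; rewrite /sign_pattern (SP_polyK sP) -map_rev revK -map_comp.
by rewrite -[RHS]map_id; apply: eq_map => -[] /=; rewrite ?ltr01 ?ltr0N1 // oppr_gt0 ltr10.
Qed.

Lemma is_SP_sign_pattern P : admissible P -> is_SP (size P).-1 (sign_pattern P).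
Proof.
case=> monP _; have P0 : (0 < size P)%N by rewrite size_poly_gt0 monic_neq0.
split; first by rewrite size_map size_rev prednK.
by rewrite -nth0 sign_patternE nth_mkseq // subn0 -lead_coefE (monicP monP) ltr01.
Qed.

Lemma sigma_mE P : admissible P ->
  sigma_m R (sign_pattern P) = sign_pattern (mirror P).
Proof.
move=> admP; have sP := is_SP_sign_pattern admP.
apply: sign_pattern_mirror => //; first exact: SP_poly_admissible sP.
exact: sign_pattern_SP_poly sP.
Qed.

Lemma sigma_rE P : admissible P ->
  sigma_r R (sign_pattern P) = sign_pattern (reversal P).
Proof.
move=> admP; have sP := is_SP_sign_pattern admP.
apply: sign_pattern_reversal => //; first exact: SP_poly_admissible sP.
exact: sign_pattern_SP_poly sP.
Qed.

End WellDefined.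

(* Main.v *)
Require Import Defs.
From mathcomp Require Import all_boot all_order all_algebra.
From mathcomp Require Import reals.
From mathcomp Require Import complex polyrcf polyorder.
From mathcomp Require Import zify ring lra.

(** Mirroring P and reversing P preserve hyperbolicity and move the roots by
    [r |-> - r] and [r |-> r^-1]; on the canonical word they act by negating the
    letters and by reading backwards, which is what they do to the list of signs
    of the roots sorted by modulus.  Hence canonicity passes from s to
    [sigma_m s] and [sigma_r s] ([canonical_sigma_m], [canonical_sigma_r]), and
    since the three patterns lie in a single orbit, it suffices to treat
    Sigma_{1,1,d-2,1}, the pattern + - + ... + -.

    By Descartes' rule, a P with this pattern has three positive roots
    a1 < a2 < a3 and d - 3 >= 2 negative roots - b; canonicity says that every
    b lies between a1 and a2 ([negative_moduli_between]).  Four of the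
    coefficient signs are used through Viete's formulas, where r ranges over
    all roots:
    - the signs at x^(d-1) and x^(d-2) give S = sum r > 0 and
      S^2 > sum r^2 >= a3^2.  Were sum b > a1 + a2, then
      0 < S = a3 - (sum b - a1 - a2) < a3 would contradict this; so
      sum b <= a1 + a2 ([sum_negative_moduli_le]).
    - the signs at x^0 and x^1 give sum 1/r > 0.
    The other signs serve to show that P takes values of one sign at all the b.
    Since P(-b) = 0, P(b) is twice the even part and twice the odd part of P
    at b.
    - For d odd the odd part has positive coefficients, so P(b) > 0.
    - For d even the even part E increases on the positive half-line, while
      O(x) / x^(d-1) decreases there, O being the odd part.  Thus if P(b) > 0
      for one b, the even part keeps P positive at every larger b and the odd
      part at every smaller one.
    If P(b) > 0 for all b, each b lies in (a1, a2) or beyond a3; the latter is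
    excluded because two of the b would then have a sum above a1 + a2.
    Otherwise d is even, there are at least three b, and each is at most a1 or
    in [a2, a3].  The sum bound allows at most one of them in [a2, a3], so that
    two are at most a1 and a third at most a3, which makes sum 1/b exceed
    1/a1 + 1/a2 + 1/a3, a contradiction. *)

Set Implicit Arguments.
Unset Strict Implicit.
Unset Printing Implicit Defensive.

Import Order.TTheory GRing.Theory Num.Theory.
Local Open Scope ring_scope.

(** * Canonical words, mirrors and reversals *)

Section SignPatterns.
Variable R : realFieldType.
Implicit Types P : {poly R}.

Lemma size_admissible P : admissible P -> (0 < size P)%N.
Proof. by move/admissible_neq0; rewrite size_poly_gt0. Qed.

(** Reading the word from right to left turns it into a list indexed by
    increasing exponents, on which derivative, mirror and reversal are easy to
    follow. *)
Lemma canonical_word_sign_pattern P : canonical_word (sign_pattern P) =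
  mkseq (fun i => (0 < P`_i.+1) != (0 < P`_i)) (size P).-1.
Proof.
rewrite /canonical_word sign_patternE /mkseq.
case: (size P) => [|n] //=; rewrite subn0.
set f := fun i => 0 < P`_(n - i); rewrite -/(f 0).
have -> : 0 < P`_n = f 0%N by rewrite /f subn0.
have pm m k : pairmap (fun x y : bool => x != y) (f m) [seq f i | i <- iota m.+1 k]
   = [seq f i != f i.+1 | i <- iota m k].
  by elim: k m => //= k IH m; rewrite IH.
rewrite pm -map_rev; apply: (@eq_from_nth _ false).
  by rewrite !size_map size_rev.
rewrite size_map size_rev size_iota => i lti.
rewrite !(nth_map 0%N) ?size_rev ?size_iota // nth_rev ?size_iota //.
rewrite !nth_iota; [|lia..].
by rewrite /f !add0n; congr ((0 < P`__) != (0 < P`__)); lia.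
Qed.

Lemma admissible_lt0 P j : admissible P -> (j < size P)%N ->
  (P`_j < 0) = ~~ (0 < P`_j).
Proof. by move=> [_ nzP] /nzP nz; rewrite -leNgt le_eqVlt (negPf nz). Qed.

Lemma mirror_admissible P : admissible P -> admissible (mirror P).
Proof.
move=> admP; have [monP nzP] := admP; split; last first.
  move=> j; rewrite size_mirror => ltj.
  by rewrite coef_mirror mulf_neq0 ?signr_eq0 ?nzP.
rewrite monicE lead_coefE size_mirror coef_mirror addnn -signr_odd odd_double.
by rewrite mul1r -lead_coefE -monicE.
Qed.

Lemma mirrorK P : mirror (mirror P) = P.
Proof.
apply/polyP => j; rewrite !coef_mirror size_mirror mulrA -exprD addnn.
by rewrite -signr_odd odd_double mul1r.
Qed.

Lemma coef_reversal P j : (j < size P)%N ->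
  (reversal P)`_j = (P`_0)^-1 * P`_((size P).-1 - j).
Proof. by move=> ltj; rewrite coefZ coef_poly ltj horner_coef0. Qed.

Lemma reversal_admissible P : admissible P -> admissible (reversal P).
Proof.
move=> admP; have [monP nzP] := admP; have P0 := size_admissible admP.
have sP := size_reversal admP; split.
  by rewrite monicE lead_coefE sP coef_reversal ?subnn ?mulVf ?nzP //; lia.
move=> j; rewrite sP => ltj.
by rewrite coef_reversal // mulf_neq0 ?invr_eq0 ?nzP //; lia.
Qed.

Lemma reversalK P : admissible P -> reversal (reversal P) = P.
Proof.
move=> admP; have [monP nzP] := admP; have P0 := size_admissible admP.
have admr := reversal_admissible admP; have sP := size_reversal admP.
apply/polyP => j; case: (ltnP j (size P)) => ltj; last first.
  by rewrite !nth_default // !size_reversal.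
rewrite !coef_reversal ?sP //; [|lia..].
have -> : ((size P).-1 - ((size P).-1 - j) = j)%N by lia.
rewrite subn0 -lead_coefE (monicP monP) mulr1 invrK mulrA mulfV ?mul1r //.
exact: nzP.
Qed.

Lemma canonical_word_mirror P : admissible P ->
  canonical_word (sign_pattern (mirror P)) =
  map negb (canonical_word (sign_pattern P)).
Proof.
move=> admP; have P0 := size_admissible admP.
rewrite !canonical_word_sign_pattern size_mirror -map_comp.
apply/eq_in_map => i; rewrite mem_iota => lti /=.
rewrite !coef_mirror addnS exprS -signr_odd.
have [lti0 lti1] : (i < size P)%N /\ (i.+1 < size P)%N by lia.
case: (odd _); rewrite ?expr0 ?expr1 ?mulN1r ?opprK !mul1r ?mulN1r oppr_gt0;
  by rewrite admissible_lt0 //; do 2!case: (0 < _).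
Qed.

Lemma canonical_word_reversal P : admissible P ->
  canonical_word (sign_pattern (reversal P)) =
  rev (canonical_word (sign_pattern P)).
Proof.
move=> admP; have [monP nzP] := admP; have P0 := size_admissible admP.
rewrite !canonical_word_sign_pattern size_reversal //.
apply: (@eq_from_nth _ false); first by rewrite size_rev !size_mkseq.
rewrite size_mkseq => i lti.
rewrite nth_rev ?size_mkseq // !nth_mkseq //; last by lia.
rewrite !coef_reversal //; [|lia..].
have -> : ((size P).-1 - i.+1).+1 = ((size P).-1 - i)%N by lia.
have [lti0 lti1] : ((size P).-1 - i.+1 < size P)%N /\
    ((size P).-1 - i < size P)%N by lia.
have := nzP 0%N P0; case: (ltgtP P`_0 0) => // P00 _.
  by rewrite !nmulr_rgt0 ?invr_lt0 // !admissible_lt0 //; do 2!case: (0 < _).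
by rewrite !pmulr_rgt0 ?invr_gt0 // eq_sym.
Qed.

(** Distinct moduli make the roots distinct, so their number forces the
    factorization: to know the roots of a mirror or a reversal it is enough to
    evaluate it. *)
Lemma roots_by_modulus_all_root P rs : P \is monic ->
  size P = (size rs).+1 -> all (root P) rs -> path <%R 0 [seq `|r| | r <- rs] ->
  roots_by_modulus P rs.
Proof.
move=> monP sP rootP pathP; split=> //.
have := @all_roots_prod_XsubC _ P rs sP rootP.
rewrite (monicP monP) scale1r; apply.
rewrite uniq_rootsE (@map_uniq _ _ Num.norm) // lt_sorted_uniq //.
exact: path_sorted pathP.
Qed.

Lemma roots_by_modulus_neq0 P rs r : roots_by_modulus P rs -> r \in rs -> r != 0.
Proof.
move=> [_ /(order_path_min lt_trans)/allP pathP] rs_r.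
by rewrite -normr_gt0; apply/pathP/map_f.
Qed.

Lemma size_roots_by_modulus P rs : roots_by_modulus P rs ->
  size P = (size rs).+1.
Proof. by case=> -> _; rewrite size_prod_XsubC. Qed.

Lemma roots_by_modulus_root P rs : roots_by_modulus P rs ->
  forall x, root P x = (x \in rs).
Proof. by case=> -> _ x; rewrite root_prod_XsubC. Qed.

Lemma mirror_roots P rs : admissible P -> roots_by_modulus P rs ->
  roots_by_modulus (mirror P) (map -%R rs).
Proof.
move=> admP Prs; apply: roots_by_modulus_all_root.
- by have [] := mirror_admissible admP.
- by rewrite size_mirror size_map (size_roots_by_modulus Prs).
- rewrite all_map; apply/allP => r; rewrite -(roots_by_modulus_root Prs).
  rewrite /root /= /mirror hornerZ horner_comp hornerN hornerX opprK.
  by move/eqP->; rewrite mulr0.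
- by rewrite -map_comp (eq_map (@normrN _ _)); case: Prs.
Qed.

Lemma reversal_roots P rs : admissible P -> roots_by_modulus P rs ->
  roots_by_modulus (reversal P) (rev [seq r^-1 | r <- rs]).
Proof.
move=> admP Prs; have sP := size_roots_by_modulus Prs.
apply: roots_by_modulus_all_root.
- by have [] := reversal_admissible admP.
- by rewrite size_reversal // size_rev size_map.
- rewrite all_rev all_map; apply/allP => r rs_r /=.
  have r0 := roots_by_modulus_neq0 Prs rs_r.
  move: rs_r; rewrite -(roots_by_modulus_root Prs) /root /= => /eqP Pr0.
  rewrite /reversal hornerZ horner_poly mulf_eq0; apply/orP; right.
  rewrite -[_ == 0](mulIr_eq0 _ (mulIf (expf_neq0 (size P).-1 r0))).
  rewrite -[X in _ == X]Pr0 horner_coef mulr_suml.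
  rewrite [X in _ == X](reindex_inj rev_ord_inj) /=; apply/eqP/eq_bigr => j _.
  have ltj := ltn_ord j.
  have -> : (size P - j.+1 = (size P).-1 - j)%N by lia.
  have jn : (j <= (size P).-1)%N by rewrite -ltnS (ltn_predK ltj).
  by rewrite -mulrA -{2}(subnKC jn) exprD exprVn mulKf ?expf_neq0.
case: Prs => _; rewrite !(path_sortedE lt_trans).
case/andP => /allP gt0 srt; apply/andP; split.
  apply/allP => x; rewrite map_rev mem_rev => /mapP[y /mapP[z zrs ->] ->].
  by rewrite normfV invr_gt0 gt0 // map_f.
rewrite map_rev rev_sorted -map_comp sorted_map.
move: srt; rewrite sorted_map; apply: sub_in_sorted (allss _) => x y xrs yrs /=.
have := gt0 `|x|; have := gt0 `|y|; rewrite !map_f // => y0 x0 xy.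
by rewrite !normfV ltf_pV2 ?posrE // ?x0 ?y0.
Qed.

(** The positional condition becomes an equality of lists of booleans, which
    commutes with [map] and [rev]. *)
Lemma canonical_orderE P : canonical_order P <->
  exists2 rs, roots_by_modulus P rs &
    canonical_word (sign_pattern P) = [seq 0 < r | r <- rs].
Proof.
split=> -[rs Prs wP]; exists rs => //.
  have sw : size (canonical_word (sign_pattern P)) = size rs.
    by rewrite canonical_word_sign_pattern size_mkseq (size_roots_by_modulus Prs).
  apply: (@eq_from_nth _ false); rewrite ?size_map sw //.
  move=> i lti; rewrite (nth_map 0) //; have := wP i lti.
  by case: nth => // /lt_gtF.
move=> i lti; rewrite wP (nth_map 0) //.
by case: ltP => //; rewrite le_eqVlt (negPf (roots_by_modulus_neq0 Prs _)) ?mem_nth.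
Qed.

End SignPatterns.

Section Canonical.
Variable R : rcfType.
Implicit Types P : {poly R}.

Lemma is_HP_roots P rs : admissible P -> roots_by_modulus P rs -> is_HP P.
Proof.
move=> admP [PE _]; split=> // z; rewrite PE rmorph_prod /=.
under eq_bigr do rewrite rmorphB /= map_polyX map_polyC /=.
rewrite -(big_map _ xpredT (fun r => 'X - r%:P)) root_prod_XsubC.
by case/mapP => r _ ->.
Qed.

(** An HP with pattern [sigma_m s] is the mirror of one with pattern [s]; negating
    the roots keeps their order by modulus and exchanges the letters. *)
Lemma canonical_sigma_m d s : canonical R d s -> canonical R d (sigma_m R s).
Proof.
move=> [sP canP]; have admS := SP_poly_admissible R sP.
have sS := sign_pattern_SP_poly R sP; split.
  have := is_SP_sign_pattern (mirror_admissible admS).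
  by rewrite size_mirror (SP_polyK R sP) size_map size_rev; case: sP => ->.
move=> P [admP _] sigP [rs Prs].
have sigM : sign_pattern (mirror P) = s.
  rewrite (sign_pattern_mirror admP (mirror_admissible admS) sigP) mirrorK.
  exact: sS.
have Mrs := mirror_roots admP Prs; have admM := mirror_admissible admP.
have /canonical_orderE[ts Mts wM] : canonical_order (mirror P).
  by apply: canP => //; [exact: is_HP_roots Mrs | exists (map -%R rs)].
apply/canonical_orderE; exists (map -%R ts).
  by rewrite -[P]mirrorK; apply: mirror_roots.
rewrite -[P]mirrorK canonical_word_mirror // wM -!map_comp.
apply/eq_in_map => t /(roots_by_modulus_neq0 Mts) /= t0.
by rewrite oppr_gt0 -leNgt le_eqVlt (negPf t0).
Qed.

(** As for [canonical_sigma_m], with inversion of the roots, which reverses their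
    order by modulus. *)
Lemma canonical_sigma_r d s : canonical R d s -> canonical R d (sigma_r R s).
Proof.
move=> [sP canP]; have admS := SP_poly_admissible R sP.
have sS := sign_pattern_SP_poly R sP; split.
  have := is_SP_sign_pattern (reversal_admissible admS).
  by rewrite size_reversal // (SP_polyK R sP) size_map size_rev; case: sP => ->.
move=> P [admP _] sigP [rs Prs].
have sigM : sign_pattern (reversal P) = s.
  rewrite (sign_pattern_reversal admP (reversal_admissible admS) sigP).
  by rewrite reversalK.
have Mrs := reversal_roots admP Prs; have admM := reversal_admissible admP.
have /canonical_orderE[ts Mts wM] : canonical_order (reversal P).
  by apply: canP => //; [exact: is_HP_roots Mrs | eexists; exact: Mrs].
apply/canonical_orderE; exists (rev [seq r^-1 | r <- ts]).
  by rewrite -[P]reversalK //; apply: reversal_roots.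
rewrite -[P]reversalK // canonical_word_reversal // wM map_rev -map_comp.
by congr rev; apply/eq_map => t /=; rewrite invr_gt0.
Qed.
End Canonical.

(** * Descartes' rule for simple roots *)

Section Descartes.
Variable R : rcfType.
Implicit Types p : {poly R}.

(** Rolle's theorem between consecutive roots. *)
Lemma interlacing_deriv_roots p a s : root p a -> path <%R a s ->
  all (root p) s ->
  exists t, [/\ size t = size s, path <%R a t & all (root p^`()) t].
Proof.
elim: s a => [|b s IH] a pa /=; first by exists [::].
case/andP => ab bs /andP[pb ps].
have [t [st bt pt]] := IH b pb bs ps.
have [c cab pc] : {c | c \in `]a, b[ & p^`().[c] = 0}.
  by apply: poly_rolle => //; rewrite (eqP pa) (eqP pb).
move: cab; rewrite in_itv => /= /andP[ac cb].
exists (c :: t); split=> /=; rewrite ?st // ?ac ?(rootE _ c) ?pc ?eqxx //=.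
case: t bt {st pt} => //= e t /andP[be ->].
by rewrite (lt_trans cb be).
Qed.

(** If P(0) and P'(0) have the same sign, P leaves 0 away from the axis and has
    to turn back before its first positive root b.  Formally, the mean value
    theorem gives a point where P' has the sign of - P(0), and P' vanishes
    between 0 and that point. *)
Lemma deriv_root_before p b : 0 < p`_0 * p`_1 -> 0 < b -> root p b ->
  exists2 c, 0 < c < b & root p^`() c.
Proof.
move=> p01 b0 /eqP pb.
have [c cab] := @poly_mvt _ 0 b p b0.
rewrite pb horner_coef0 subr0 sub0r => pc.
move: cab; rewrite in_itv => /= /andP[c0 cb].
have [|x x0c px] := @poly_ivtoo _ p^`() 0 c (ltW c0).
  rewrite horner_coef0 coef_deriv mulr1n -(pmulr_llt0 _ b0) -mulrA -pc.
  by rewrite mulrN oppr_lt0 mulrC.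
exists x => //; move: x0c; rewrite in_itv => /= /andP[-> xc].
exact: lt_trans cb.
Qed.

Lemma canonical_word_deriv p : (1 < size p)%N ->
  canonical_word (sign_pattern p) =
  ((0 < p`_1) != (0 < p`_0)) :: canonical_word (sign_pattern p^`()).
Proof.
rewrite !canonical_word_sign_pattern size_deriv.
case: (size p) => [|[|n]] //= _; rewrite /mkseq /= (iotaDl 1) -map_comp.
congr cons; apply/eq_map => i /=.
by rewrite !coef_deriv add1n !pmulrn_lgt0.
Qed.

(** Induction on the degree: passing to the derivative removes one letter of the
    word and one root by Rolle; when the removed letter is a preservation,
    [deriv_root_before] gives the root back. *)
Lemma descartes p s : (forall j, (j < size p)%N -> p`_j != 0) -> p != 0 ->
  path <%R 0 s -> all (root p) s ->
  (size s <= count id (canonical_word (sign_pattern p)))%N.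
Proof.
elim: {p}(size p) {-2}p (erefl (size p)) s => [|n IH] p sp s nzp p0 s0 ps.
  by move/eqP: sp; rewrite size_poly_eq0 (negPf p0).
case: s s0 ps => [|b s] //= /andP[b0 bs] /andP[pb ps].
have sp1 : (1 < size p)%N by apply: root_size_gt1 pb.
have nz0 : p`_0 != 0 by apply: nzp; lia.
have nz1 : p`_1 != 0 by apply: nzp; lia.
have sd : size p^`() = n by rewrite size_deriv sp.
have d0 : p^`() != 0 by rewrite -size_poly_gt0 sd; lia.
have nzd j : (j < size p^`())%N -> p^`()`_j != 0.
  by rewrite sd => ltj; rewrite coef_deriv mulrn_eq0 negb_or /= nzp // sp.
have [t [st bt pt]] := interlacing_deriv_roots pb bs ps.
rewrite canonical_word_deriv //=.
have [p01|p01] := ltP 0 (p`_0 * p`_1).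
  have [c /andP[c0 cb] pc] := deriv_root_before p01 b0 pb.
  have := IH _ sd (c :: t) nzd d0.
  rewrite /= c0 pc pt st; move=> /(_ _ isT) le; apply: leq_trans (leq_addl _ _).
  apply: le; case: t bt {st pt} => //= e t /andP[be ->].
  by rewrite (lt_trans cb be).
have -> : (0 < p`_1) != (0 < p`_0).
  move: p01; case: (ltgtP p`_0 0) nz0 => // p0s _;
    case: (ltgtP p`_1 0) nz1 => // p1s _.
    by rewrite leNgt nmulr_rgt0 ?p1s.
  by rewrite leNgt pmulr_rgt0 ?p1s.
rewrite add1n ltnS -st; apply: IH => //.
case: t bt {st pt} => //= e t /andP[be ->].
by rewrite (lt_trans b0 be).
Qed.
End Descartes.

(** * Position of the negative roots *)

Section Vieta.
Variable R : fieldType.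
Implicit Types rs : seq R.

(** The logarithmic derivative at 0. *)
Lemma coef1_prod_XsubC rs : {in rs, forall r, r != 0} ->
  (\prod_(r <- rs) ('X - r%:P))`_1 =
  - (\prod_(r <- rs) ('X - r%:P))`_0 * \sum_(r <- rs) r^-1.
Proof.
elim: rs => [|r rs IH] nz; first by rewrite !big_nil !coefC mulr0.
have r0 : r != 0 by rewrite nz ?mem_head.
have {}IH := IH (fun x xs => nz x (mem_behead (s := r :: rs) xs)).
rewrite !big_cons !mulrBl !coefB !coefXM !coefCM /= IH.
by field.
Qed.

(** The second elementary symmetric function in terms of power sums. *)
Lemma coefPnn_prod_XsubC rs : (1 < size rs)%N ->
  (\prod_(r <- rs) ('X - r%:P))`_(size rs - 2) *+ 2 =
  (\sum_(r <- rs) r) ^+ 2 - \sum_(r <- rs) r ^+ 2.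
Proof.
elim: rs => [|r [|s rs] IH] // _; rewrite big_cons.
have -> : (size [:: r, s & rs] - 2 = size rs)%N by rewrite /= subn2.
rewrite mulrBl coefB coefXM coefCM.
have := @coefPn_prod_XsubC _ (s :: rs) isT; rewrite /= => ->.
case: rs IH => [|t rs] IH.
  by rewrite !big_cons !big_nil /=; ring.
have := IH isT; rewrite /= subn2 /= mulrnBl => ->.
by rewrite !(big_cons _ _ r); ring.
Qed.
End Vieta.

Lemma uniq_exists_neq (T : eqType) (s : seq T) (x : T) :
  uniq s -> (1 < size s)%N -> exists2 y, y \in s & x != y.
Proof.
case: s => [|y [|z s]] //= /andP[]; rewrite inE negb_or => /andP[yz _] _ _.
have [->|] := eqVneq x y; last by exists y; rewrite ?inE ?eqxx.
by exists z; rewrite ?inE ?eqxx ?orbT.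
Qed.

Section Configuration.
Variable R : realFieldType.
Implicit Types (P : {poly R}) (bs : seq R).

(** If the sum B of [bs] exceeded a1 + a2, the sum S of all the roots would be
    a3 - (B - a1 - a2), between 0 and a3, so that S^2 < a3^2. *)
Lemma sum_negative_moduli_le (a1 a2 a3 : R) bs :
  let rs := [:: a1; a2; a3] ++ map -%R bs in
  0 < a3 -> 0 < \sum_(r <- rs) r ->
  \sum_(r <- rs) r ^+ 2 < (\sum_(r <- rs) r) ^+ 2 ->
  \sum_(b <- bs) b <= a1 + a2.
Proof.
rewrite /= !big_cons !big_map => a3_gt0.
rewrite sumrN.
set B := \sum_(b <- bs) b.
have : 0 <= \sum_(b <- bs) (- b) ^+ 2 by apply: sumr_ge0 => b _; apply: sqr_ge0.
set Q := \sum_(b <- bs) _ => Q0 S0 SQ; rewrite leNgt; apply/negP => aB.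
have a1s := sqr_ge0 a1; have a2s := sqr_ge0 a2.
set S := a1 + _ in S0 SQ.
(* S = a3 - (B - (a1 + a2)) with B > a1 + a2. *)
have Sa3 : S < a3 by rewrite /S; lra.
have : S ^+ 2 < a3 ^+ 2 by rewrite ltr_pXn2r // nnegrE ltW.
lra.
Qed.

Lemma leD2_sum bs x y : uniq bs -> {in bs, forall b, 0 <= b} ->
  x \in bs -> y \in bs -> x != y -> x + y <= \sum_(b <- bs) b.
Proof.
move=> ubs bs0 xbs ybs xy; rewrite (big_rem x) //= lerD2l.
have ybs' : y \in rem x bs by rewrite mem_rem_uniq // inE eq_sym xy.
rewrite (big_rem y) //= lerDl big_seq; apply: sumr_ge0.
by move=> b /mem_rem/mem_rem/bs0.
Qed.

(** The signs of the coefficients in Sigma_{1,1,d-2,1}, by increasing exponent. *)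
Definition signs_11m1 d P := forall j, (j <= d)%N ->
  if (j == 0)%N || (j == d.-1)%N then P`_j < 0 else 0 < P`_j.

(** Twice the even part. *)
Lemma horner_even_part P x d : size P = d.+1 ->
  P.[x] + P.[- x] = \sum_(i < d.+1) P`_i * (1 + (-1) ^+ i) * x ^+ i.
Proof.
move=> sP; rewrite !horner_coef sP -big_split; apply: eq_bigr => i _ /=.
by rewrite (exprNn x) mulrDr mulrDl mulr1 mulrA.
Qed.

(** Twice the odd part. *)
Lemma horner_odd_part P x d : size P = d.+1 ->
  P.[x] - P.[- x] = \sum_(i < d.+1) P`_i * (1 - (-1) ^+ i) * x ^+ i.
Proof.
move=> sP; rewrite !horner_coef sP -sumrB; apply: eq_bigr => i _ /=.
by rewrite (exprNn x) mulrBr mulrBl mulr1 mulrA.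
Qed.

(** P(x) = P(x) - P(-x) is twice the odd part, whose coefficients are all
    positive since the two exceptional exponents 0 and d - 1 are even. *)
Lemma horner_negative_modulus_odd P d x : (3 < d)%N -> odd d -> size P = d.+1 ->
  signs_11m1 d P -> 0 < x -> root P (- x) -> 0 < P.[x].
Proof.
move=> d3 oddd sP sgn x0 /eqP Px.
have -> : P.[x] = P.[x] - P.[- x] by rewrite Px subr0.
rewrite (horner_odd_part _ sP).
have lt1 : (1 < d.+1)%N by lia.
rewrite (bigD1 (Ordinal lt1)) //=; apply: ltr_wpDr.
  apply: sumr_ge0 => i _; apply: mulr_ge0; last exact/exprn_ge0/ltW.
  rewrite -signr_odd; case: (boolP (odd i)) => /= oi; last by rewrite subrr mulr0.
  have /sgn : (i <= d)%N by rewrite -ltnS.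
  have -> : (nat_of_ord i == 0)%N || (nat_of_ord i == d.-1)%N = false by lia.
  by move=> Pi; apply: mulr_ge0; [exact: ltW | rewrite expr1 opprK addr_ge0].
have /sgn : (1 <= d)%N by lia.
have -> /= : (1 == d.-1)%N = false by lia.
by move=> P1; rewrite expr1 opprK !mulr_gt0 // addr_gt0.
Qed.

(** For x <= y, compare even parts: only the constant term is negative, so the
    even part is nondecreasing on the positive half-line.  For y <= x, compare
    odd parts: only the term of top odd degree d - 1 is negative, so the odd
    part divided by x^(d-1) is nonincreasing. *)
Lemma horner_negative_moduli_even P d x y : (3 < d)%N -> ~~ odd d ->
  size P = d.+1 -> signs_11m1 d P -> 0 < x -> 0 < y ->
  root P (- x) -> root P (- y) -> 0 < P.[x] -> 0 < P.[y].
Proof.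
move=> d3 evend sP sgn x0 y0 /eqP Px /eqP Py Px0.
have [xy|/ltW yx] := leP x y.
  apply: lt_le_trans Px0 _.
  rewrite -[P.[x]]addr0 -[P.[y]]addr0 -{1}Px -Py !(horner_even_part _ sP).
  apply: ler_sum => i _; rewrite -signr_odd.
  case: (boolP (odd i)) => /= oi; first by rewrite subrr mulr0 !mul0r.
  have [->//|i0] := eqVneq (nat_of_ord i) 0%N.
  have /sgn : (i <= d)%N by rewrite -ltnS.
  have -> : (nat_of_ord i == 0)%N || (nat_of_ord i == d.-1)%N = false by lia.
  move=> Pi; rewrite ler_wpM2l ?lerXn2r ?nnegrE //; try exact: ltW.
  by rewrite mulr_ge0 ?addr_ge0 // ltW.
(* Cross-multiplied form of the monotonicity of the odd part over x^(d-1). *)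
have : y ^+ d.-1 * P.[x] <= x ^+ d.-1 * P.[y].
  rewrite -[P.[x]]subr0 -[P.[y]]subr0 -{1}Px -Py !(horner_odd_part _ sP).
  rewrite !mulr_sumr; apply: ler_sum => i _; rewrite -signr_odd.
  case: (boolP (odd i)) => /= oi; last by rewrite subrr mulr0 !mul0r !mulr0.
  have ltid := ltn_ord i.
  have [-> |id] := eqVneq (nat_of_ord i) d.-1.
    by rewrite mulrCA [leRHS]mulrCA [y ^+ _ * _]mulrC.
  have /sgn : (i <= d)%N by rewrite -ltnS.
  have -> : (nat_of_ord i == 0)%N || (nat_of_ord i == d.-1)%N = false by lia.
  move=> Pi; rewrite mulrCA [leRHS]mulrCA; apply: ler_wpM2l.
    by rewrite expr1 opprK mulr_ge0 ?addr_ge0 // ltW.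
  have le_i : (i <= d.-1)%N by lia.
  rewrite -(subnKC le_i) !exprD mulrAC [leRHS]mulrAC [y ^+ i * _]mulrC.
  apply: ler_wpM2l; first by rewrite mulr_ge0 // exprn_ge0 // ltW.
  by rewrite lerXn2r // nnegrE ltW.
have yd : 0 < y ^+ d.-1 by rewrite exprn_gt0.
have xd : 0 < x ^+ d.-1 by rewrite exprn_gt0.
by move/(lt_le_trans (mulr_gt0 yd Px0)); rewrite pmulr_rgt0.
Qed.

(** The geometric core: the positions of the roots relative to each other follow
    from the bound on [\sum_(b <- bs) b], the positivity of the sum of the
    inverses of the roots, and the fact that P has one sign on [bs]. *)
Lemma negative_moduli_between (d : nat) (a1 a2 a3 : R) bs :
  let rs := [:: a1; a2; a3] ++ map -%R bs in
  let P := \prod_(r <- rs) ('X - r%:P) in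
  (4 < d)%N -> size bs = (d - 3)%N -> signs_11m1 d P ->
  0 < a1 -> a1 < a2 -> a2 < a3 -> path <%R 0 bs ->
  {in bs, forall b, a1 < b < a2}.
Proof.
move=> rs P d_gt4 sbs sgn a1_gt0 a12 a23 pbs.
have d_gt3 : (3 < d)%N by lia.
have [a2_gt0 a3_gt0] : 0 < a2 /\ 0 < a3 by split; lra.
have srs : size rs = d by rewrite size_cat size_map sbs /=; lia.
have sP : size P = d.+1 by rewrite size_prod_XsubC srs.
have [bs_gt1 bs_gt2] : (1 < size bs)%N /\ (~~ odd d -> 2 < size bs)%N.
  by rewrite sbs; split=> [|evend]; lia.
have ubs : uniq bs by apply: lt_sorted_uniq; apply: path_sorted pbs.
have bs_gt0 b : b \in bs -> 0 < b by apply/allP/(order_path_min lt_trans).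
have rs_neq0 : {in rs, forall r, r != 0}.
  move=> r; rewrite /rs /= !inE => /or4P[/eqP->|/eqP->|/eqP->|];
    try by rewrite gt_eqF.
  by case/mapP => b /bs_gt0 b0 ->; rewrite oppr_eq0 gt_eqF.
have S1 : 0 < \sum_(r <- rs) r.
  have := @sgn d.-1; rewrite eqxx orbT => /(_ (leq_pred _)).
  by rewrite -srs coefPn_prod_XsubC ?oppr_lt0.
have S2 : \sum_(r <- rs) r ^+ 2 < (\sum_(r <- rs) r) ^+ 2.
  have := @sgn (d - 2)%N (leq_subr _ _).
  have -> : ((d - 2 == 0) || (d - 2 == d.-1))%N = false by lia.
  by rewrite -(@pmulrn_lgt0 _ _ 2) // -{1}srs coefPnn_prod_XsubC ?subr_gt0.
have Sm1 : 0 < \sum_(r <- rs) r^-1.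
  have := @sgn 1%N; have := @sgn 0%N (leq0n _) => /= P0.
  have -> : (1 == d.-1)%N = false by lia.
  rewrite coef1_prod_XsubC // pmulr_rgt0 ?oppr_gt0 //; apply; lia.
have sum_le := sum_negative_moduli_le a3_gt0 S1 S2.
have sum2 x y : x \in bs -> y \in bs -> x != y -> x + y <= a1 + a2.
  move=> xbs ybs xy; apply: le_trans sum_le; apply: leD2_sum => //.
  by move=> b /bs_gt0/ltW.
have bs_root b : b \in bs -> root P (- b).
  by move=> bbs; rewrite root_prod_XsubC mem_cat map_f ?orbT.
have P_sign b : b \in bs ->
    (0 < P.[b]) = (0 < (b - a1) * (b - a2) * (b - a3)).
  move=> bbs; rewrite /P big_cat /= !big_cons big_nil mulr1 big_map.
  rewrite !hornerM !hornerXsubC !mulrA pmulr_lgt0 // horner_prod.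
  rewrite big_seq; apply: prodr_gt0 => c cbs.
  by rewrite hornerXsubC opprK addr_gt0 ?bs_gt0.
have all_pos : {in bs, forall b, 0 < P.[b]} -> {in bs, forall b, a1 < b < a2}.
  move=> Pbs b bbs.
  (* Below a1 the cubic factor of P is nonpositive. *)
  have a1_lt c : c \in bs -> a1 < c.
    move=> cbs; have := Pbs c cbs; rewrite P_sign // ltNge => /negP Pc.
    rewrite ltNge; apply/negP => ca1; apply: Pc.
    rewrite -mulrA mulr_le0_ge0 ?subr_le0 // mulr_le0 // subr_le0; lra.
  rewrite a1_lt //= ltNge; apply/negP => a2b.
  have a3b : a3 < b.
    have := Pbs b bbs; rewrite P_sign // pmulr_rgt0 ?subr_gt0 //.
    have := a1_lt b bbs; move: (P_sign b bbs) (Pbs b bbs) => -> + a1b.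
    have [->|nb] := eqVneq b a2; first by rewrite subrr mulr0 mul0r ltxx.
    by rewrite pmulr_rgt0 ?mulr_gt0 ?subr_gt0 // lt_neqAle eq_sym nb.
  (* b > a3 together with any other element of bs exceeds a1 + a2. *)
  have [c cbs cb] := uniq_exists_neq b ubs bs_gt1.
  have := sum2 b c bbs cbs cb; have := a1_lt c cbs; lra.
have [oddd|evend] := boolP (odd d).
  apply: all_pos => b bbs.
  by apply: (horner_negative_modulus_odd d_gt3 oddd sP sgn); auto.
(* For d even, a positive value of P at one b spreads to all of them. *)
have [/hasP[b bbs Pb]|/hasPn noP] := boolP (has (fun b => 0 < P.[b]) bs).
  apply: all_pos => c cbs.
  by apply: (@horner_negative_moduli_even P d b c d_gt3 evend sP sgn); auto.
exfalso.
(* From here d is even, hence bs has at least three elements, and P is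
   nonpositive on all of them. *)
have {noP}bs_le b : b \in bs -> b <= a1 \/ a2 <= b <= a3.
  move=> bbs; have := noP b bbs; rewrite P_sign // -leNgt => Pb.
  have [ba1|a1b] := leP b a1; [by left | right].
  move: Pb; rewrite -mulrA pmulr_rle0 ?subr_gt0 // => Pb.
  apply/andP; split; rewrite leNgt; apply/negP => h.
    by move: Pb; rewrite leNgt nmulr_rgt0 ?subr_lt0 // (lt_trans h).
  by move: Pb; rewrite leNgt pmulr_rgt0 ?subr_gt0 ?h // (lt_trans a23).
have := bs_gt2 evend.
move: Sm1 pbs sum2 bs_le bs_gt0.
rewrite /rs !big_cat /= !big_cons big_nil addr0 big_map.
case: (bs) => [|x1 [|x2 [|x3 t]]] //= + /and4P[x1_gt0 x12 x23 _] sum2 bs_le bs_gt0 _.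
(* Otherwise x2 and x3 would both be at least a2. *)
have x2_le : x2 <= a1.
  case: (bs_le x2) => [|//|/andP[a2x _]]; first by rewrite !inE eqxx orbT.
  have := sum2 x2 x3; rewrite !inE !eqxx !orbT lt_eqF // => /(_ isT isT isT); lra.
have x3_le : x3 <= a3.
  by case: (bs_le x3) => [|?|/andP[_ //]]; [rewrite !inE eqxx !orbT | lra].
rewrite !big_cons !invrN.
have : \sum_(b <- t) (- b)^-1 <= 0.
  rewrite big_seq; apply: sumr_le0 => b bt.
  by rewrite invrN oppr_le0 invr_ge0 ltW // bs_gt0 // !inE bt !orbT.
have : a1^-1 <= x1^-1 by rewrite lef_pV2 ?posrE //; lra.
have : a2^-1 < x2^-1 by rewrite ltf_pV2 ?posrE //; lra.
have : a3^-1 <= x3^-1 by rewrite lef_pV2 ?posrE //; lra.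
lra.
Qed.
End Configuration.

(** * Canonicity of the pattern with blocks 1, 1, d - 2, 1 *)

Section RootCount.
Variable R : rcfType.
Implicit Types (P : {poly R}) (rs : seq R).

Lemma path_positive_roots P rs : roots_by_modulus P rs ->
  path <%R 0 [seq r <- rs | 0 < r].
Proof.
case=> _ /path_sorted; rewrite sorted_map (path_sortedE lt_trans) filter_all /=.
have tr : transitive (relpre Num.norm <%R : rel R) by move=> y x z; apply: lt_trans.
move/(sorted_filter tr (fun r => 0 < r)).
apply: sub_in_sorted (filter_all _ _) => x y x0 y0 /=.
by rewrite !gtr0_norm.
Qed.

Lemma positive_roots_le P rs : admissible P -> roots_by_modulus P rs ->
  (size [seq r <- rs | (0 < r)%R] <= count id (canonical_word (sign_pattern P)))%N.
Proof.
move=> admP Prs; apply: descartes.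
- by case: admP.
- exact: admissible_neq0.
- exact: path_positive_roots Prs.
apply/allP => r; rewrite mem_filter (roots_by_modulus_root Prs).
by case/andP.
Qed.

Lemma predC_positive P rs : roots_by_modulus P rs ->
  [seq r <- rs | ~~ (0 < r)] = map -%R [seq r <- map -%R rs | 0 < r].
Proof.
move=> Prs; rewrite filter_map -map_comp map_id_in => [|r _ /=]; last exact: opprK.
apply: eq_in_filter => r /(roots_by_modulus_neq0 Prs) r0 /=.
by rewrite oppr_gt0 -leNgt le_eqVlt (negPf r0).
Qed.

(** Descartes' rule bounds the positive roots of P and, applied to the mirror, its
    negative roots; the two bounds add up to the number of roots, so both are
    attained. *)
Lemma size_positive_roots P rs : admissible P -> roots_by_modulus P rs ->
  size [seq r <- rs | 0 < r] = count id (canonical_word (sign_pattern P)).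
Proof.
move=> admP Prs; apply/eqP; rewrite eqn_leq positive_roots_le //=.
have := positive_roots_le (mirror_admissible admP) (mirror_roots admP Prs).
rewrite canonical_word_mirror // count_map -(size_map -%R) -(predC_positive Prs).
rewrite !size_filter.
set w := canonical_word _.
have sw : size w = size rs.
  by rewrite /w canonical_word_sign_pattern size_mkseq (size_roots_by_modulus Prs).
have szw : (count id w + count (preim negb id) w)%N = size w := count_predC id w.
rewrite -(leq_add2l (count id w)) szw sw -(count_predC (fun r => 0 < r) rs).
by rewrite leq_add2r.
Qed.

Lemma sign_pattern_11m1 P d : (5 <= d)%N -> admissible P ->
  sign_pattern P = Sigma [:: 1; 1; d - 2; 1]%N ->
  size P = d.+1 /\ signs_11m1 d P.
Proof.
move=> d5 admP sigP.
have sP : size P = d.+1.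
  have := congr1 size sigP; rewrite sign_patternE size_mkseq => ->.
  by rewrite /= size_cat size_nseq /=; lia.
split=> // j lejd.
have ltj : (j < size P)%N by rewrite sP.
have := congr1 (nth false ^~ (d - j)%N) sigP.
rewrite /= sign_patternE nth_mkseq sP /=; last by lia.
have -> : (d - (d - j) = j)%N by lia.
have -> : nth false [:: true, false & nseq (d - 2) true ++ [:: false]] (d - j)
   = ~~ ((j == 0) || (j == d.-1))%N.
  have [->|jd] := eqVneq j d; first by rewrite subnn /=; lia.
  have [->|jd1] := eqVneq j d.-1.
    by rewrite orbT (_ : d - d.-1 = 1)%N //; lia.
  have -> : (d - j = (d - j - 2).+2)%N by lia.
  rewrite /= nth_cat size_nseq nth_nseq; case: ifP => ltd.
    by rewrite orbF ltd; lia.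
  have -> : j = 0%N by lia.
  by rewrite subn0 subnn.
move=> Pj; case: ifP Pj => [_ /negbT Pj|_ ->//].
by rewrite admissible_lt0.
Qed.

Lemma canonical_word_11m1 P d : (5 <= d)%N -> admissible P ->
  sign_pattern P = Sigma [:: 1; 1; d - 2; 1]%N ->
  canonical_word (sign_pattern P) = true :: nseq (d - 3) false ++ [:: true; true].
Proof.
move=> d5 admP sigP; have [sP sgn] := sign_pattern_11m1 d5 admP sigP.
have pos j : (j <= d)%N -> (0 < P`_j) = ~~ ((j == 0) || (j == d.-1))%N.
  move=> /[dup] lej /sgn; case: ifP => // _ P0; first exact: lt_gtF.
rewrite canonical_word_sign_pattern sP.
apply: (@eq_from_nth _ false).
  by rewrite size_mkseq /= size_cat size_nseq /=; lia.
rewrite size_mkseq /= => i lti; rewrite nth_mkseq // !pos; [|lia..].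
case: i lti => [|i] lti /=; first by lia.
rewrite nth_cat size_nseq nth_nseq if_same; case: ifP => h; first by lia.
have [->|->] : i = (d - 3)%N \/ i = (d - 3).+1 by lia.
  by rewrite subnn /=; lia.
by rewrite subSnn /=; lia.
Qed.

(** The list of roots sorted by modulus is determined by its elements, so it is
    a1, then the negative roots, then a2 and a3. *)
Lemma canonical_11m1 d : (5 <= d)%N ->
  canonical R d (Sigma [:: 1; 1; d - 2; 1]%N).
Proof.
move=> d5; split; first by split=> //=; rewrite size_cat size_nseq /=; lia.
move=> P [admP _] sigP [rs Prs]; apply/canonical_orderE; exists rs => //.
have wP := canonical_word_11m1 d5 admP sigP.
have [sP sgn] := sign_pattern_11m1 d5 admP sigP.
have Mrs := mirror_roots admP Prs.
have s_pos := size_positive_roots admP Prs.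
have s_neg := size_positive_roots (mirror_admissible admP) Mrs.
rewrite canonical_word_mirror // in s_neg.
rewrite wP /= count_cat count_nseq /= mul0n in s_pos.
rewrite wP /= map_cat map_nseq count_cat count_nseq /= mul1n !addn0 add0n in s_neg.
have p_pos := path_positive_roots Prs; have p_neg := path_positive_roots Mrs.
have nE := predC_positive Prs.
set bs := [seq r <- map -%R rs | 0 < r] in s_neg p_neg nE.
have perm_rs : perm_eq rs ([seq r <- rs | 0 < r] ++ map -%R bs).
  by rewrite -nE perm_sym; apply/permPl/perm_filterC.
move: s_pos p_pos perm_rs; case: [seq r <- rs | 0 < r] => [|a1 [|a2 [|a3 [|//]]]] //.
move=> _ /and4P[a1_gt0 a12 a23 _] perm_rs.
have bs_gt0 b : b \in bs -> 0 < b by rewrite mem_filter => /andP[].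
have btw : {in bs, forall b, a1 < b < a2}.
  apply: (negative_moduli_between (d := d) (a3 := a3)) => //.
  by rewrite -(perm_big _ perm_rs); case: Prs => <-.
have norm_tr : transitive (relpre Num.norm <%R : rel R).
  by move=> y x z; apply: lt_trans.
have sorted_bs : sorted (relpre Num.norm <%R) (map -%R bs).
  rewrite sorted_map; move: (path_sorted p_neg).
  apply: sub_in_sorted (allss bs) => x y xbs ybs /=.
  by rewrite !normrN !gtr0_norm ?bs_gt0.
have rsE : rs = a1 :: map -%R bs ++ [:: a2; a3].
  apply: (@irr_sorted_eq _ (relpre Num.norm <%R)).
  - exact: norm_tr.
  - by move=> x; apply: ltxx.
  - by rewrite -sorted_map; case: Prs => _ /path_sorted.
  - rewrite /= cat_path (path_sortedE norm_tr) /=.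
    have [a2_gt0 a3_gt0] : 0 < a2 /\ 0 < a3 by split; lra.
    have last_bs : `|last a1 (map -%R bs)| < a2.
      move: btw bs_gt0; clear s_neg p_neg nE perm_rs sorted_bs.
      case/lastP: bs => [|t b] btw bs_gt0 /=.
        by rewrite gtr0_norm.
      have bbs : b \in rcons t b by rewrite mem_rcons mem_head.
      rewrite map_rcons last_rcons normrN gtr0_norm ?bs_gt0 //.
      by case/andP: (btw b bbs).
    rewrite (gtr0_norm a2_gt0) (gtr0_norm a3_gt0) last_bs a23 !andbT.
    apply/andP; split.
      rewrite all_map; apply/allP => b bbs /=.
      rewrite normrN (gtr0_norm a1_gt0) gtr0_norm ?bs_gt0 //.
      by case/andP: (btw b bbs).
    exact: sorted_bs.
  - move=> x; rewrite (perm_mem perm_rs) /= !inE mem_cat !inE.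
    by case: (x == a1); case: (x == a2); case: (x == a3); rewrite ?orbT ?orbF.
rewrite wP {}rsE /= a1_gt0 map_cat /= -s_neg.
rewrite (lt_trans a1_gt0 a12) (lt_trans a1_gt0 (lt_trans a12 a23)).
congr (_ :: _ ++ _); rewrite -map_comp; symmetry.
rewrite -(size_map (fun b => 0 < - b)); apply/all_pred1P; rewrite all_map.
by apply/allP => b /bs_gt0 b0 /=; rewrite oppr_gt0 lt_gtF.
Qed.
End RootCount.

(** * The orbit of the pattern under the involutions *)

Lemma cat_nseqS (T : Type) n (x : T) s : nseq n x ++ x :: s = x :: nseq n x ++ s.
Proof. by elim: n => //= n ->. Qed.

Section Involutions.
Variable R : realFieldType.
Implicit Types (P : {poly R}) (s : seq bool).

(** The effect of the mirror on a sign pattern: every other sign changes.  The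
    Boolean tells whether the head changes; with it, blocks of equal signs can
    be treated by recursion. *)
Fixpoint flip_alternate (b : bool) s : seq bool :=
  if s is a :: s' then (a (+) b) :: flip_alternate (~~ b) s' else [::].

Lemma flip_alternateE b s : flip_alternate b s =
  mkseq (fun i => nth false s i (+) (b (+) odd i)) (size s).
Proof.
elim: s b => //= a s IH b; rewrite /mkseq /= addbF (iotaDl 1) -map_comp IH.
congr cons; apply: eq_map => i /=.
by rewrite addbN addNb.
Qed.

Lemma sigma_m_flip d s : is_SP d s -> sigma_m R s = flip_alternate false s.
Proof.
move=> sP; have admS := SP_poly_admissible R sP.
have sS : size (SP_poly R s) = size s.
  by rewrite (SP_polyK R sP) size_map size_rev.
have size_s : (0 < size s)%N by case: sP => ->.
rewrite /sigma_m sign_patternE flip_alternateE size_mirror sS.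
apply/eq_in_map => i; rewrite mem_iota => lti.
have -> : nth false s i = (0 < (SP_poly R s)`_((size s).-1 - i)).
  rewrite -{1}(sign_pattern_SP_poly R sP) sign_patternE nth_mkseq sS //; lia.
rewrite coef_mirror sS -signr_odd.
have -> : odd ((size s).-1 + ((size s).-1 - i)) = odd i by lia.
case: (odd i); rewrite ?expr0 ?expr1 ?mul1r ?addbF //=.
rewrite mulN1r oppr_gt0 admissible_lt0 // ?sS ?addbT //; lia.
Qed.

Lemma sigma_r_rev d s : is_SP d s ->
  sigma_r R s = [seq b == last false s | b <- rev s].
Proof.
move=> sP; have admS := SP_poly_admissible R sP; have [_ nzS] := admS.
have sS : size (SP_poly R s) = size s.
  by rewrite (SP_polyK R sP) size_map size_rev.
have size_s : (0 < size s)%N by case: sP => ->.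
have sE i : (i < size s)%N ->
    nth false s i = (0 < (SP_poly R s)`_((size s).-1 - i)).
  by move=> lti; rewrite -{1}(sign_pattern_SP_poly R sP) sign_patternE nth_mkseq sS.
have lastE : last false s = (0 < (SP_poly R s)`_0).
  by rewrite -nth_last sE ?subnn //; lia.
rewrite /sigma_r sign_patternE size_reversal // sS.
apply: (@eq_from_nth _ false); first by rewrite size_mkseq size_map size_rev.
rewrite size_mkseq => i lti.
rewrite nth_mkseq // (nth_map false) ?size_rev // nth_rev // lastE sE; last by lia.
rewrite coef_reversal sS; last by lia.
have -> : ((size s).-1 - (size s - i.+1) = (size s).-1 - ((size s).-1 - i))%N by lia.
set j := (_ - (_ - i))%N.
have ltj : (j < size (SP_poly R s))%N by rewrite sS /j; lia.
have := nzS 0%N; rewrite sS => /(_ size_s).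
case: (ltgtP (SP_poly R s)`_0 0) => // S0 _.
  by rewrite nmulr_rgt0 ?invr_lt0 // admissible_lt0 // eqbF_neg.
by rewrite pmulr_rgt0 ?invr_gt0 // eqb_id.
Qed.

(** Alternate flipping breaks a block of k equal signs into k blocks of length 1. *)
Lemma flip_alternate_nseq b c k t ms :
  flip_alternate (b (+) odd k) t = sign_blocks (c (+) (b (+) odd k)) ms ->
  flip_alternate b (nseq k c ++ t) =
  sign_blocks (c (+) b) (nseq k 1%N ++ ms).
Proof.
elim: k b => [|k IH] b /=; first by rewrite addbF.
by rewrite addbN -addNb => /IH ->; rewrite addbN.
Qed.
End Involutions.

Theorem corollary1 (R : realType) (d : nat) (hd : (5 <= d)%N) :
  [/\ canonical R d (Sigma (nseq 2 1%N ++ [:: (d - 2)%N] ++ nseq 1 1%N)),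
      canonical R d (Sigma ([:: 2%N] ++ nseq (d - 4)%N 1%N ++ [:: 3%N])) &
      canonical R d (Sigma ([:: 3%N] ++ nseq (d - 4)%N 1%N ++ [:: 2%N]))]
  /\
  [/\ Sigma (nseq 2 1%N ++ [:: (d - 2)%N] ++ nseq 1 1%N) =
        sigma_r R (Sigma (nseq 1 1%N ++ [:: (d - 2)%N] ++ nseq 2 1%N)),
      Sigma ([:: 2%N] ++ nseq (d - 4)%N 1%N ++ [:: 3%N]) =
        sigma_m R (Sigma (nseq 1 1%N ++ [:: (d - 2)%N] ++ nseq 2 1%N)) &
      Sigma ([:: 3%N] ++ nseq (d - 4)%N 1%N ++ [:: 2%N]) =
        sigma_mr R (Sigma (nseq 1 1%N ++ [:: (d - 2)%N] ++ nseq 2 1%N))].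
Proof.
set s0 := Sigma (nseq 1 1%N ++ _); set s1 := Sigma (nseq 2 1%N ++ _).
set s2 := Sigma ([:: 2%N] ++ _); set s3 := Sigma ([:: 3%N] ++ _).
have can1 : canonical R d s1 by exact: canonical_11m1.
have [sP1 _] := can1.
have sP0 : is_SP d s0 by split=> //=; rewrite size_cat size_nseq /=; lia.
have E10 : s1 = sigma_r R s0.
  rewrite (sigma_r_rev R sP0) /s0 /s1 /Sigma /= rev_cons rev_cat rev_nseq.
  by rewrite last_cat /= map_rcons map_nseq cats1.
have E01 : s0 = sigma_r R s1.
  rewrite (sigma_r_rev R sP1) /s0 /s1 /Sigma /= !rev_cons rev_cat rev_nseq.
  by rewrite last_cat /= !map_rcons map_nseq -!cats1 -catA.
have [k dE] : exists k, d = (k + 5)%N by exists (d - 5)%N; lia.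
have d2 : (d - 2 = k.+1.+2)%N by lia.
have d4 : (d - 4 = k.+1)%N by lia.
have E20 : s2 = sigma_m R s0.
  rewrite (sigma_m_flip R sP0) /s0 /s2 /Sigma d2 d4.
  (* After flipping, the three signs split off at the end coincide. *)
  have -> : sign_blocks true (nseq 1 1 ++ [:: k.+3] ++ nseq 2 1)%N =
      [:: true; false] ++ nseq k.+1 false ++ [:: false; true; false].
    by rewrite /= -(cat_nseqS k.+1).
  congr [:: _, _ & _]; symmetry.
  apply: (@flip_alternate_nseq false false k.+1 [:: false; true; false] [:: 3%N]).
  by case: (odd _).
have E31 : s3 = sigma_m R s1.
  rewrite (sigma_m_flip R sP1) /s1 /s3 /Sigma d2 d4.
  (* After flipping, the first three signs coincide, and so do the last two. *)
  have -> : sign_blocks true (nseq 2 1 ++ [:: k.+3] ++ nseq 1 1)%N =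
      [:: true; false; true] ++ nseq k.+1 true ++ [:: true; false].
    by rewrite /= -(cat_nseqS k.+1).
  congr [:: _, _, _ & _]; symmetry.
  apply: (@flip_alternate_nseq true true k.+1 [:: true; false] [:: 2%N]).
  by case: (odd _).
have can0 : canonical R d s0 by rewrite E01; exact: canonical_sigma_r.
split; split=> //; first by rewrite E20; exact: canonical_sigma_m.
- by rewrite E31; exact: canonical_sigma_m.
- by rewrite /sigma_mr -E10.
Qed.
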